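(* For all integers $n\ge 0$, $m\ge 0$, $k\ge 1$ and the parameters $a,q,l$ below, the generalized $m$-poly-Cauchy numbers of the first kind satisfy \[ \mathcal{C}_{n+1,m}^{(k)}(a,q,L)=l\Big(1-\frac{1}{a+m+1}\Big)^{k}\mathcal{C}_{n,m+1}^{(k)}(a,q,L)-nq\,\mathcal{C}_{n,m}^{(k)}(a,q,L), \] and $\mathcal{C}_{0,m}^{(k)}(a,q,L)=\dfrac{l^{a}}{a^{k}}$ for all $m\ge 0$.
   Context: Let $k\ge1$ be an integer, let $a,q,l_1,\dots,l_k$ be nonzero real numbers, $L=(l_1,\dots,l_k)$ and $l=\prod_{i=1}^k l_i$; all denominators of the form $a+j$ ($j\ge 0$ an integer) are assumed nonzero, and $l^{a+i}$ means $l^a l^i$. Let $s(n,i)$ denote the (signed) Stirling numbers of the first kind, defined by $\frac{1}{i!}(\ln(1+x))^i=\sum_{n\ge i}s(n,i)\frac{x^n}{n!}$ (so $s(n,i)=0$ for $i>n$). For integers $n,m\ge 0$ define the generalized $m$-poly-Cauchy numbers of the first kind \[ \mathcal{C}_{n,m}^{(k)}(a,q,L)=\frac{(a+m)^k}{a^k}\sum_{i=0}^{n}s(n,i)\frac{q^{n-i}l^{a+i}}{(a+i+m)^k}. \] *)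

(* Defs.v *)
From Stdlib Require Import Reals List Factorial Lra Lia.
From Coquelicot Require Import Coquelicot.
Open Scope R_scope.

(* s is determined by this predicate, and [stirling1_ex] below shows that such
   an s exists.  The first conjunct expresses that the series starts at n = i. *)
Definition is_stirling1 (s : nat -> nat -> R) : Prop :=
  (forall n i : nat, (n < i)%nat -> s n i = 0) /\
  (forall i : nat,
     locally 0 (fun x : R =>
       is_pseries (fun n => s n i / INR (fact n)) x
         (/ INR (fact i) * ln (1 + x) ^ i))).

Definition prodL (L : list R) : R := fold_right Rmult 1 L.

Definition Cexp (z : C) : C :=
  (exp (Re z) * cos (Im z), exp (Re z) * sin (Im z)).

(* l = prodL L may be negative, so l^a is the complex power exp (a * log l).
   [logl] is any determination of log l: every choice of branch of l^a is
   covered, and for 0 < l the choice logl = ln l gives the real power. *)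
Definition is_Clog (l : R) (logl : C) : Prop := Cexp logl = RtoC l.

Definition lpow (logl : C) (a : R) : C := Cexp (RtoC a * logl)%C.

(* The factor [lpow logl a * l ^ i] is l^(a+i), read as l^a * l^i. *)
Definition polyCauchy (s : nat -> nat -> R) (k : nat) (a q : R) (L : list R)
    (logl : C) (n m : nat) : C :=
  (RtoC ((a + INR m) ^ k / a ^ k) *
   sum_n (fun i : nat =>
     RtoC (s n i) *
     (RtoC (q ^ (n - i)) * (lpow logl a * RtoC (prodL L ^ i))
      / RtoC ((a + INR i + INR m) ^ k))) n)%C.

Lemma lpow_Rpower (l a : R) :
  0 < l -> is_Clog l (RtoC (ln l)) /\ lpow (RtoC (ln l)) a = RtoC (Rpower l a).
Proof.
intros Hl; unfold is_Clog, lpow, Cexp, RtoC, Rpower; simpl.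
replace (a * 0 + 0 * ln l) with 0 by ring.
replace (a * ln l - 0 * 0) with (a * ln l) by ring.
rewrite cos_0, sin_0, !Rmult_1_r, !Rmult_0_r, exp_ln by assumption.
split; reflexivity.
Qed.

Lemma is_Clog_ex (l : R) : l <> 0 -> exists logl : C, is_Clog l logl.
Proof.
intros Hl; destruct (Rlt_or_le 0 l) as [Hp|Hn].
- exists (RtoC (ln l)); apply (lpow_Rpower l 1 Hp).
- exists (ln (- l), PI); unfold is_Clog, Cexp, RtoC; simpl.
  rewrite exp_ln, cos_PI, sin_PI by lra; f_equal; ring.
Qed.

Definition log1p_coef : nat -> R := PS_Int (fun n => (-1) ^ n).

Lemma CV_radius_unit (a : nat -> R) :
  (forall x, Rabs x < 1 -> ex_pseries a x) ->
  forall x, Rabs x < 1 -> Rbar_lt (Rabs x) (CV_radius a).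
Proof.
intros Ha x Hx.
set (y := (Rabs x + 1) / 2).
assert (H0 := Rabs_pos x).
assert (Hy : Rabs y = y) by (apply Rabs_pos_eq; unfold y; lra).
apply Rbar_lt_le_trans with (Rabs y); [rewrite Hy; unfold y; simpl; lra|].
destruct (Rbar_lt_le_dec (CV_radius a) (Rabs y)) as [Hlt|Hle]; [|exact Hle].
exfalso; apply (CV_disk_outside a y Hlt).
assert (Hex : ex_pseries a y) by (apply Ha; rewrite Hy; unfold y; lra).
apply is_lim_seq_ext with (fun n => scal (pow_n y n) (a n)).
- intros n; rewrite pow_n_pow; apply Rmult_comm.
- apply ex_series_lim_0; exact Hex.
Qed.

Lemma is_pseries_alt_geom (x : R) : Rabs x < 1 ->
  is_pseries (fun n => (-1) ^ n) x (/ (1 + x)).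
Proof.
intros Hx; unfold is_pseries.
apply is_series_ext with (fun n => (- x) ^ n).
- intros n; change ((- x) ^ n = pow_n x n * (-1) ^ n); rewrite (pow_n_pow x n).
  rewrite <- Rpow_mult_distr; f_equal; ring.
- replace (1 + x) with (1 - - x) by ring.
  apply is_series_geom; rewrite Rabs_Ropp; exact Hx.
Qed.

Lemma is_pseries_log1p (x : R) : Rabs x < 1 ->
  is_pseries log1p_coef x (ln (1 + x)).
Proof.
intros Hx.
assert (Hr : forall y, Rabs y < 1 ->
  Rbar_lt (Rabs y) (CV_radius (fun n => (-1) ^ n))).
{ apply CV_radius_unit; intros y Hy; exists (/ (1 + y)).
  exact (is_pseries_alt_geom y Hy). }
assert (Hb : forall y, Rmin 0 x <= y <= Rmax 0 x -> Rabs y < 1).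
{ intros y; unfold Rmin, Rmax; destruct (Rle_dec 0 x);
  apply Rabs_def2 in Hx; intros; apply Rabs_def1; lra. }
replace (ln (1 + x)) with (RInt (PSeries (fun n => (-1) ^ n)) 0 x).
{ apply is_pseries_RInt, Hr, Hx. }
apply is_RInt_unique.
replace (ln (1 + x)) with (minus (ln (1 + x)) (ln (1 + 0))).
2:{ rewrite Rplus_0_r, ln_1; unfold minus, plus, opp; simpl; ring. }
apply (is_RInt_derive (fun y => ln (1 + y))).
- intros y Hy; apply Hb in Hy.
  rewrite (is_pseries_unique _ _ _ (is_pseries_alt_geom y Hy)).
  apply Rabs_def2 in Hy; auto_derive; [lra|field; lra].
- intros y Hy; apply Hb in Hy.
  apply continuity_pt_filterlim.
  apply PSeries_continuity, Hr, Hy.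
Qed.

Fixpoint log1p_pow_coef (i : nat) : nat -> R :=
  match i with
  | O => fun n => match n with O => 1 | S _ => 0 end
  | S j => PS_mult log1p_coef (log1p_pow_coef j)
  end.

Lemma is_pseries_log1p_pow (i : nat) (x : R) : Rabs x < 1 ->
  is_pseries (log1p_pow_coef i) x (ln (1 + x) ^ i).
Proof.
revert x; induction i as [|i IH]; intros x Hx.
- simpl; unfold is_pseries.
  apply filterlim_ext with (fun _ : nat => 1); [|apply filterlim_const].
  intros n; induction n as [|n IHn].
  + rewrite sum_O; change (1 = 1 * 1); ring.
  + rewrite sum_Sn, <- IHn.
    change (1 = 1 + (pow_n x (S n) * 0)); ring.
- simpl; apply is_pseries_mult.
  + apply is_pseries_log1p, Hx.
  + apply IH, Hx.
  + apply CV_radius_unit; [|exact Hx].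
    intros y Hy; eexists; apply (is_pseries_log1p y Hy).
  + apply CV_radius_unit; [|exact Hx].
    intros y Hy; eexists; apply (IH y Hy).
Qed.

Lemma log1p_pow_coef_0 (i n : nat) : (n < i)%nat -> log1p_pow_coef i n = 0.
Proof.
revert n; induction i as [|i IH]; intros n Hn; [lia|].
simpl; unfold PS_mult; apply sum_eq_R0; intros [|j] Hj.
- unfold log1p_coef, PS_Int; ring.
- rewrite IH by lia; ring.
Qed.

Lemma stirling1_ex : exists s : nat -> nat -> R, is_stirling1 s.
Proof.
exists (fun n i => INR (fact n) * (/ INR (fact i) * log1p_pow_coef i n)).
split.
- intros n i Hn; rewrite log1p_pow_coef_0 by exact Hn; ring.
- intros i; exists (mkposreal 1 Rlt_0_1); intros x Hx.
  assert (Hx1 : Rabs x < 1).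
  { replace x with (minus x 0); [exact Hx|].
    unfold minus, plus, opp; simpl; ring. }
  apply is_pseries_ext with (PS_scal (/ INR (fact i)) (log1p_pow_coef i)).
  + intros n; assert (H1 := INR_fact_neq_0 n); assert (H2 := INR_fact_neq_0 i).
    change (/ INR (fact i) * log1p_pow_coef i n
      = INR (fact n) * (/ INR (fact i) * log1p_pow_coef i n) / INR (fact n)).
    field; auto.
  + apply (is_pseries_scal (V := R_NormedModule) (/ INR (fact i)) (log1p_pow_coef i) x (ln (1 + x) ^ i)); [apply Rmult_comm|].
    apply is_pseries_log1p_pow, Hx1.
Qed.

(* Main.v *)
Require Import Defs.
From Stdlib Require Import Reals List Factorial Lra Lia.
From Coquelicot Require Import Coquelicot.
Open Scope R_scope.

(** Since [f_i x = ln (1 + x) ^ i / i!] satisfies [(1 + x) f_{i+1}' = f_i],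
    comparing power series coefficients gives
    [s (n+1) (i+1) = s n i - n s n (i+1)].  Substituting this in
    [C_{n+1,m}] splits the sum in two: the part with [- n s n (i+1)] is
    [- n q C_{n,m}], and in the other the shift of [i] by one turns the
    denominators [a + i + m] into [a + i + (m + 1)]. *)

(** At [d / 2], a nonzero point of the neighbourhood, the series converges, so its terms tend to 0.
    Strictly outside the disk of convergence they cannot, hence the radius is at least [d / 2]. *)
Lemma locally_ex_pseries_CV_radius_pos (c : nat -> R) :
  locally 0 (fun x : R => ex_pseries c x) -> Rbar_lt 0 (CV_radius c).
Proof.
intros [d Hd].
assert (Hd0 := cond_pos d).
assert (Hy : Rabs (d / 2) = d / 2) by (apply Rabs_pos_eq; lra).
apply Rbar_lt_le_trans with (Rabs (d / 2)); [rewrite Hy; simpl; lra|].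
destruct (Rbar_lt_le_dec (CV_radius c) (Rabs (d / 2))) as [Hlt|Hle];
  [|exact Hle].
exfalso; apply (CV_disk_outside c (d / 2) Hlt).
assert (Hex : ex_pseries c (d / 2)).
{ apply Hd; change (Rabs (d / 2 - 0) < d).
  rewrite Rminus_0_r, Hy; lra. }
apply is_lim_seq_ext with (fun n => scal (pow_n (d / 2) n) (c n)).
- intros n; rewrite pow_n_pow; apply Rmult_comm.
- apply ex_series_lim_0; exact Hex.
Qed.

Lemma locally_is_pseries_CV_radius_pos (c : nat -> R) (f : R -> R) :
  locally 0 (fun x : R => is_pseries c x (f x)) -> Rbar_lt 0 (CV_radius c).
Proof.
intros Hc; apply locally_ex_pseries_CV_radius_pos.
apply filter_imp with (2 := Hc); intros x Hx; exists (f x); exact Hx.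
Qed.

(** Identity theorem for power series; every comparison of coefficients below goes through it. *)
Lemma locally_is_pseries_inj (b c : nat -> R) (f : R -> R) (n : nat) :
  locally 0 (fun x : R => is_pseries b x (f x)) ->
  locally 0 (fun x : R => is_pseries c x (f x)) -> b n = c n.
Proof.
intros Hb Hc; apply PSeries_ext_recip.
- exact (locally_is_pseries_CV_radius_pos b f Hb).
- exact (locally_is_pseries_CV_radius_pos c f Hc).
- apply filter_imp with (2 := filter_and _ _ Hb Hc); intros x [H1 H2].
  rewrite (is_pseries_unique _ _ _ H1), (is_pseries_unique _ _ _ H2).
  reflexivity.
Qed.

Lemma locally_0_Rabs_lt (r : Rbar) :
  Rbar_lt 0 r -> locally 0 (fun x : R => Rbar_lt (Rabs x) r).
Proof.
destruct r as [r| |]; intros Hr; simpl in Hr; try easy.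
- exists (mkposreal r Hr); intros x Hx; simpl.
  change (Rabs (x - 0) < r) in Hx; rewrite Rminus_0_r in Hx; exact Hx.
- apply filter_forall; intros x; exact I.
Qed.

Lemma locally_is_pseries_derive (c : nat -> R) (f df : R -> R) :
  locally 0 (fun x : R => is_pseries c x (f x)) ->
  locally 0 (fun x : R => is_derive f x (df x)) ->
  locally 0 (fun x : R => is_pseries (PS_derive c) x (df x)).
Proof.
intros Hc Hdf.
assert (Hr := locally_0_Rabs_lt _ (locally_is_pseries_CV_radius_pos c f Hc)).
(* Differentiating at [x] requires [f] and [PSeries c] to agree on a whole neighbourhood of [x], not
   only at [x]. *)
apply locally_locally in Hc.
apply filter_imp with (2 := filter_and _ _ Hc (filter_and _ _ Hdf Hr)).
intros x [Hx [Hfx Hrx]].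
replace (df x) with (PSeries (PS_derive c) x).
- apply PSeries_correct, CV_radius_inside; rewrite CV_radius_derive; exact Hrx.
- rewrite <- (is_derive_unique _ _ _ Hfx).
  symmetry; apply is_derive_unique.
  apply is_derive_ext_loc with (PSeries c).
  + apply filter_imp with (2 := Hx); intros y Hy.
    exact (is_pseries_unique _ _ _ Hy).
  + apply is_derive_PSeries, Hrx.
Qed.

(** For [i = 0] the generating function is the constant 1, whose coefficients are
    [log1p_pow_coef 0]. *)
Lemma is_stirling1_n_0 (s : nat -> nat -> R) (n : nat) :
  is_stirling1 s -> s n 0%nat = match n with O => 1 | S _ => 0 end.
Proof.
intros [_ Hs].
assert (H : s n 0%nat / INR (fact n) = log1p_pow_coef 0 n).
{ apply (locally_is_pseries_inj (fun n => s n 0%nat / INR (fact n)) _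
    (fun x => / INR (fact 0) * ln (1 + x) ^ 0)).
  - exact (Hs 0%nat).
  - apply filter_imp with (2 := locally_0_Rabs_lt 1 Rlt_0_1); intros x Hx.
    replace (/ INR (fact 0) * ln (1 + x) ^ 0) with (ln (1 + x) ^ 0)
      by (simpl; field).
    apply is_pseries_log1p_pow, Hx. }
assert (Hn := INR_fact_neq_0 n).
replace (s n 0%nat) with (s n 0%nat / INR (fact n) * INR (fact n))
  by (field; exact Hn).
rewrite H; destruct n; simpl; ring.
Qed.

(** The boundary case of the recurrence, with no term coming from column [i - 1]. Both sides vanish:
    on the right, either [n = 0] or [s n 0 = 0]. *)
Lemma is_stirling1_rec_0 (s : nat -> nat -> R) (n : nat) :
  is_stirling1 s -> s (S n) 0%nat = - INR n * s n 0%nat.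
Proof.
intros Hs; rewrite !is_stirling1_n_0 by exact Hs; destruct n; simpl; ring.
Qed.

Lemma is_derive_log1p_pow_fact (i : nat) (x : R) : -1 < x ->
  is_derive (fun x => / INR (fact (S i)) * ln (1 + x) ^ S i) x
    (/ INR (fact i) * ln (1 + x) ^ i / (1 + x)).
Proof.
intros Hx.
auto_derive; [lra|].
change (fact i + i * fact i)%nat with (fact (S i)).
change (match i with O => 1 | S _ => INR i + 1 end) with (INR (S i)).
rewrite fact_simpl, mult_INR.
assert (H1 := INR_fact_neq_0 i); assert (H2 := not_0_INR (S i) ltac:(lia)).
field; repeat split; auto; lra.
Qed.

Lemma is_stirling1_rec (s : nat -> nat -> R) (n i : nat) :
  is_stirling1 s -> s (S n) (S i) = s n i - INR n * s n (S i).
Proof.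
intros [_ Hs].
set (c := fun n => s n (S i) / INR (fact n)).
assert (Hd : locally 0 (fun x : R =>
  is_pseries (PS_derive c) x (/ INR (fact i) * ln (1 + x) ^ i / (1 + x)))).
{ apply (locally_is_pseries_derive c _ _ (Hs (S i))).
  apply filter_imp with (2 := locally_0_Rabs_lt 1 Rlt_0_1); intros x Hx.
  apply is_derive_log1p_pow_fact; apply Rabs_def2 in Hx; lra. }
(* The left side is the coefficient of [x ^ n] in [(1 + x) f'], where [f] has coefficients [c];
   multiplication by [x] is the shift [PS_incr_1]. *)
assert (H : PS_plus (PS_derive c) (PS_incr_1 (PS_derive c)) n
  = s n i / INR (fact n)).
{ apply (locally_is_pseries_inj _ (fun n => s n i / INR (fact n))
    (fun x => / INR (fact i) * ln (1 + x) ^ i)); [|exact (Hs i)].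
  apply filter_imp
    with (2 := filter_and _ _ Hd (locally_0_Rabs_lt 1 Rlt_0_1)).
  intros x [Hx Hx1].
  set (v := / INR (fact i) * ln (1 + x) ^ i) in *.
  replace v with (plus (v / (1 + x)) (scal x (v / (1 + x)))).
  - apply (is_pseries_plus (V := R_NormedModule)); [exact Hx|].
    apply (is_pseries_incr_1 (V := R_NormedModule)), Hx.
  - change (v / (1 + x) + x * (v / (1 + x)) = v).
    apply Rabs_def2 in Hx1; field; lra. }
assert (Hfn := INR_fact_neq_0 n).
assert (HSn := not_0_INR (S n) ltac:(lia)).
assert (H1 : PS_derive c n = s (S n) (S i) / INR (fact n)).
{ unfold PS_derive, c; rewrite fact_simpl, mult_INR; field; auto. }
assert (H2 : PS_incr_1 (PS_derive c) n = INR n * s n (S i) / INR (fact n)).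
(* The shifted series has constant term 0, which agrees with the factor [INR 0]. *)
{ destruct n as [|n].
  - change (0 = 0 * s 0%nat (S i) / 1); field.
  - change (@eq R (INR (S n) * (s (S n) (S i) / INR (fact (S n))))
      (INR (S n) * s (S n) (S i) / INR (fact (S n)))).
    field; auto. }
change (PS_derive c n + PS_incr_1 (PS_derive c) n = s n i / INR (fact n)) in H.
rewrite H1, H2 in H.
apply Rmult_eq_reg_r with (/ INR (fact n)); [|apply Rinv_neq_0_compat, Hfn].
unfold Rdiv in H; lra.
Qed.

(** The summation form of the recurrence: [H] collects the terms from column [i - 1], reindexed by
    one, and so stops at [n], while [G] keeps the index [i]. *)
Lemma sum_n_split_shift (F G H : nat -> C) (n : nat) :
  F O = G O -> (forall j, (j <= n)%nat -> F (S j) = (H j + G (S j))%C) ->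
  sum_n F (S n) = (sum_n H n + sum_n G (S n))%C.
Proof.
intros H0; induction n as [|n IH]; intros HS.
- rewrite !sum_Sn, !sum_O, H0, HS by lia.
  change (G O + (H O + G 1%nat) = H O + (G O + G 1%nat))%C; ring.
- rewrite sum_Sn, IH, HS by (auto with arith).
  rewrite (sum_Sn H n), (sum_Sn G (S n)).
  change (sum_n H n + sum_n G (S n) + (H (S n) + G (S (S n)))
    = sum_n H n + H (S n) + (sum_n G (S n) + G (S (S n))))%C; ring.
Qed.

Lemma sum_n_Cmult_l (z : C) (F : nat -> C) (n : nat) :
  sum_n (fun i => z * F i)%C n = (z * sum_n F n)%C.
Proof. exact (sum_n_mult_l (K := C_Ring) z F n). Qed.

Theorem theorem3
  (s : nat -> nat -> R) (Hs : is_stirling1 s)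
  (k : nat) (Hk : (1 <= k)%nat)
  (a q : R) (Ha : a <> 0) (Hq : q <> 0)
  (L : list R) (HLk : length L = k) (HL : forall x : R, In x L -> x <> 0)
  (Hden : forall j : nat, a + INR j <> 0)
  (logl : C) (Hlog : is_Clog (prodL L) logl) :
  (forall n m : nat,
     polyCauchy s k a q L logl (S n) m =
     (RtoC (prodL L * (1 - 1 / (a + INR m + 1)) ^ k)
        * polyCauchy s k a q L logl n (S m)
      - RtoC (INR n * q) * polyCauchy s k a q L logl n m)%C) /\
  (forall m : nat, polyCauchy s k a q L logl 0 m = (lpow logl a / RtoC (a ^ k))%C).
Proof.
assert (Hd : forall i m, (a + INR i + INR m) ^ k <> 0).
{ intros i m; apply pow_nonzero; rewrite Rplus_assoc, <- plus_INR; apply Hden. }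
split.
- intros n m; unfold polyCauchy.
  set (l := prodL L); set (p := lpow logl a).
  set (T := fun n m i : nat => (RtoC (s n i) * (RtoC (q ^ (n - i)) *
    (p * RtoC (l ^ i)) / RtoC ((a + INR i + INR m) ^ k)))%C).
  fold (T (S n) m) (T n (S m)) (T n m).
  assert (HT : sum_n (T (S n) m) (S n) =
    (RtoC l * sum_n (T n (S m)) n - RtoC (INR n * q) * sum_n (T n m) n)%C).
  (* The sum of [T n m] is extended to [S n], as the splitting lemma requires; the added term
     contains [s n (S n) = 0]. *)
  { replace (RtoC l * sum_n (T n (S m)) n
        - RtoC (INR n * q) * sum_n (T n m) n)%C
      with (RtoC l * sum_n (T n (S m)) n
        + RtoC (- (INR n * q)) * sum_n (T n m) (S n))%C.
    - rewrite <- !sum_n_Cmult_l.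
      apply (sum_n_split_shift (T (S n) m)
        (fun i => RtoC (- (INR n * q)) * T n m i)%C
        (fun i => RtoC l * T n (S m) i)%C).
      + unfold T; rewrite is_stirling1_rec_0 by exact Hs.
        rewrite !Nat.sub_0_r; simpl (q ^ S n).
        rewrite RtoC_opp, !RtoC_mult, RtoC_opp; unfold Cdiv; ring.
      + intros j Hj; unfold T; rewrite is_stirling1_rec by exact Hs.
        replace (a + INR (S j) + INR m) with (a + INR j + INR (S m))
          by (rewrite !S_INR; ring).
        simpl (S n - S j)%nat; simpl (l ^ S j).
        (* For [j = n] the truncated [n - S n] is 0, so [q * q ^ (n - S j)] is not [q ^ (n - j)];
           the mismatch is harmless because [s n (S n) = 0]. *)
        destruct (Nat.eq_dec j n) as [->|Hjn].
        * rewrite (proj1 Hs n (S n)) by lia.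
          rewrite Rmult_0_r, Rminus_0_r, RtoC_mult; unfold Cdiv; ring.
        * replace (n - j)%nat with (S (n - S j)) by lia; simpl (q ^ S _).
          rewrite RtoC_minus, RtoC_opp, !RtoC_mult; unfold Cdiv; ring.
    - rewrite (sum_Sn (T n m)).
      assert (HTn : T n m (S n) = 0%C).
      { unfold T; rewrite (proj1 Hs n (S n)) by lia; apply Cmult_0_l. }
      rewrite HTn; change (@plus _) with Cplus.
      rewrite RtoC_opp; ring. }
  rewrite HT.
  (* Since [a + m = (1 - 1 / (a + m + 1)) (a + m + 1)], this turns the prefactor for [m] into the
     one for [m + 1]. *)
  assert (Hc : (a + INR m) ^ k / a ^ k = (1 - 1 / (a + INR m + 1)) ^ k
    * ((a + INR (S m)) ^ k / a ^ k)).
  { assert (HSm := Hden (S m)); rewrite S_INR in HSm |- *.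
    replace (a + INR m)
      with ((1 - 1 / (a + INR m + 1)) * (a + (INR m + 1))) at 1
      by (field; lra).
    rewrite Rpow_mult_distr; unfold Rdiv; ring. }
  rewrite (RtoC_mult l).
  transitivity (RtoC l * RtoC ((a + INR m) ^ k / a ^ k) * sum_n (T n (S m)) n
    - RtoC (INR n * q) * (RtoC ((a + INR m) ^ k / a ^ k) * sum_n (T n m) n))%C;
    [ring|].
  rewrite Hc at 1; rewrite RtoC_mult; ring.
(* Only [i = 0] remains, and its denominator [(a + m) ^ k] cancels against the prefactor. *)
- intros m; unfold polyCauchy; rewrite sum_O, is_stirling1_n_0 by exact Hs.
  assert (Hm := Hd 0%nat m); simpl INR in Hm |- *; simpl.
  rewrite Rplus_0_r in Hm |- *.
  assert (Hak := pow_nonzero a k Ha).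
  rewrite RtoC_div by exact Hak.
  field; split; intros E; apply RtoC_inj in E; contradiction.
Qed.
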